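(* Let $(V,g)$ be a Euclidean real vector space of dimension $n$ and let $R=R(t)$ be a one-parameter family of symmetric $(2,2)$ double forms on $V$ satisfying the first Bianchi identity. Then, for every integer $k$ with $4\le 2k\le n$, $$\frac{d}{dt}h_{2k}(R)=\Bigl\langle k\,N_{2k-2}(R),\frac{dR}{dt}\Bigr\rangle,$$ where $h_{2k}(R)=\frac{1}{(n-2k)!}*\bigl(g^{n-2k}R^k\bigr)$ and $N_{2k-2}(R)=*\frac{g^{n-2k}R^{k-1}}{(n-2k)!}$.
   Context: Let $(V,g)$ be a Euclidean real vector space of dimension $n$ ($g$ fixed, independent of $t$). A $(p,q)$ double form is an element of $\mathcal D^{p,q}=\Lambda^pV^*\otimes\Lambda^qV^*$, identified with a bilinear form $\Lambda^pV\times\Lambda^qV\to\mathbb R$. A $(2,2)$ double form $R$ is symmetric if $R(u,v)=R(v,u)$ for all $u,v\in\Lambda^2V$; it satisfies the first Bianchi identity if $\sum_{j=1}^{3}(-1)^jR(x_1\wedge\dots\wedge\hat{x}_j\wedge\dots\wedge x_3,\;x_j\wedge y)=0$ for all $x_1,x_2,x_3,y\in V$, where the hat denotes omission. Exterior product of double forms: $(\theta_1\otimes\theta_2)(\theta_3\otimes\theta_4)=(\theta_1\wedge\theta_3)\otimes(\theta_2\wedge\theta_4)$, extended bilinearly; all products and powers in the claim are exterior products, with zeroth power equal to $1$, and $g$ is regarded as a $(1,1)$ double form. Inner product of double forms: $\langle\theta_1\otimes\theta_2,\theta_3\otimes\theta_4\rangle=\langle\theta_1,\theta_3\rangle\langle\theta_2,\theta_4\rangle$,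 using the inner product on $\Lambda^pV^*$ for which the $e^{i_1}\wedge\dots\wedge e^{i_p}$, $i_1<\dots<i_p$, are orthonormal when $(e^i)$ is dual to an orthonormal basis of $V$. Double Hodge star: for a $(p,p)$ double form $\omega$, $*\omega$ is the $(n-p,n-p)$ double form $*\omega(u,v)=\omega( *u,*v)$, with $*$ on the right the usual Hodge star $\Lambda^{n-p}V\to\Lambda^{p}V$ for a chosen orientation (the result does not depend on it). A $(0,0)$ double form is a scalar. *)

(* Defs.v *)
From HB Require Import structures.
From mathcomp Require Import all_boot all_order all_algebra.
From mathcomp Require Import all_classical all_reals all_analysis.
From mathcomp Require Import ring.
Set Implicit Arguments.
Unset Strict Implicit.
Unset Printing Implicit Defensive.
Import Order.TTheory GRing.Theory Num.Theory.
Import numFieldNormedType.Exports.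
Local Open Scope ring_scope.

(* An exterior p-form is given by its values on decomposable p-vectors:        *)
(* [th [:: x1; ...; xp]] is the value of th on x1 /\ ... /\ xp.  Forms of all  *)
(* degrees share the type [seq V -> K], a p-form being 0 on sequences of       *)
(* length different from p, so that degrees never occur in types.  Likewise a  *)
(* (p,q) double form is a function [seq V -> seq V -> K], where [om x y] is    *)
(* the value on the pair of wedge products of the vectors of x and of y.       *)
Section DoubleForms.
Variables (K : realType) (V : vectType K).
Implicit Types (th eta : seq V -> K) (om mu : seq V -> seq V -> K).

Definition is_ext_form (p : nat) th : Prop :=
  [/\ forall x, size x != p -> th x = 0,
      forall s1 s2 (a : K) (u v : V),
        th (s1 ++ (a *: u + v) :: s2) = a * th (s1 ++ u :: s2) + th (s1 ++ v :: s2)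
    & forall s1 s2 s3 (u : V), th (s1 ++ u :: s2 ++ u :: s3) = 0].

Definition is_double_form (p q : nat) om : Prop :=
  (forall y, is_ext_form p (fun x => om x y)) /\ (forall x, is_ext_form q (om x)).

Definition symmetric_df om : Prop := forall x y, om x y = om y x.

(* The index j starts at 0, whence the exponent j.+1. *)
Definition first_bianchi om : Prop :=
  forall (x : 3.-tuple V) (y : V),
    \sum_(j < 3) (-1) ^+ j.+1 * om (take j x ++ drop j.+1 x) [:: tnth x j; y] = 0.

(* Signature of the shuffle listing the positions selected by m before the    *)
(* others: the exponent counts the pairs i < j with i unselected, j selected.  *)
Definition shuffle_sign (m : bitseq) : K :=
  (-1) ^+ (\sum_(i < size m) \sum_(j < size m | (i < j)%N)
             (~~ nth false m i && nth false m j)).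

Definition form_wedge th eta : seq V -> K := fun x =>
  \sum_(m : (size x).-tuple bool)
     shuffle_sign m * th (mask m x) * eta (mask (map negb m) x).

Definition form_tensor th eta : seq V -> seq V -> K := fun x y => th x * eta y.

Definition df_mul om mu : seq V -> seq V -> K := fun x y =>
  \sum_(m : (size x).-tuple bool) \sum_(m' : (size y).-tuple bool)
     shuffle_sign m * shuffle_sign m'
     * om (mask m x) (mask m' y)
     * mu (mask (map negb m) x) (mask (map negb m') y).

Lemma df_mul_tensor th1 th2 th3 th4 :
  df_mul (form_tensor th1 th2) (form_tensor th3 th4)
  = form_tensor (form_wedge th1 th3) (form_wedge th2 th4).
Proof.
apply/funext => x; apply/funext => y; rewrite /df_mul /form_tensor /form_wedge big_distrlr /=.
by apply: eq_bigr => m _; apply: eq_bigr => m' _; ring.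
Qed.

Definition df_one : seq V -> seq V -> K := fun x y => (nilp x && nilp y)%:R.

Definition df_pow om (k : nat) : seq V -> seq V -> K := iter k (df_mul om) df_one.

Definition df_scale (c : K) om : seq V -> seq V -> K := fun x y => c * om x y.

(* (0,0) double form as a scalar *)
Definition df_scalar om : K := om [::] [::].

Definition metric_df (g : V -> V -> K) : seq V -> seq V -> K := fun x y =>
  match x, y with [:: u], [:: v] => g u v | _, _ => 0 end.

Definition df_ddt (R : K -> seq V -> seq V -> K) (t : K) : seq V -> seq V -> K :=
  fun x y => derive1 (fun s => R s x y) t.

(* Below, e is a g-orthonormal basis.  For a mask I, [mask I e] lists the      *)
(* e_i, i in I, in increasing order, i.e. it is e_{i1} /\ ... /\ e_{ip}.       *)
Section Euclidean.
Variables (g : {dot V for idfun}) (n : nat) (e : n.-tuple V).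

Definition form_inner th eta : K :=
  \sum_(I : n.-tuple bool) th (mask I e) * eta (mask I e).

Definition df_inner om mu : K :=
  \sum_(I : n.-tuple bool) \sum_(J : n.-tuple bool)
     om (mask I e) (mask J e) * mu (mask I e) (mask J e).

Lemma df_inner_tensor th1 th2 th3 th4 :
  df_inner (form_tensor th1 th2) (form_tensor th3 th4)
  = form_inner th1 th3 * form_inner th2 th4.
Proof.
rewrite /df_inner /form_inner big_distrlr /=; apply: eq_bigr => I _.
by apply: eq_bigr => J _; rewrite /form_tensor mulrACA.
Qed.

(* Volume form of the orientation given by e, as an n-form. *)
Definition volume_form (s : seq V) : K :=
  if size s == n then \det (\matrix_(i < n, j < n) g (tnth e i) (nth 0 s j))
  else 0.

(* Let E = e_1 /\ ... /\ e_n.  For u = x1 /\ ... /\ xr, the Hodge star *u is    *)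
(* the (n-r)-vector with u /\ w = <*u, w> E for all (n-r)-vectors w; hence      *)
(* *u = \sum_I volume_form (x ++ e_I) e_I, which is expanded by bilinearity in  *)
(* (df_star om)(u, v) = om ( *u, *v).  Only the I with n - r elements           *)
(* contribute, as volume_form vanishes on sequences of length <> n.             *)
Definition df_star om : seq V -> seq V -> K := fun x y =>
  \sum_(I : n.-tuple bool) \sum_(J : n.-tuple bool)
     volume_form (x ++ mask I e) * volume_form (y ++ mask J e)
     * om (mask I e) (mask J e).

(* h_{2k} *)
Definition h_2k (k : nat) om : K :=
  ((n - 2 * k)`!%:R)^-1
  * df_scalar (df_star (df_mul (df_pow (metric_df g) (n - 2 * k)) (df_pow om k))).

(* N_{2k-2}; note that the parameter is k *)
Definition N_2k2 (k : nat) om : seq V -> seq V -> K :=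
  df_star (df_scale ((n - 2 * k)`!%:R)^-1
             (df_mul (df_pow (metric_df g) (n - 2 * k)) (df_pow om k.-1))).

End Euclidean.
End DoubleForms.

(* Main.v *)
Require Import Defs.
From HB Require Import structures.
From mathcomp Require Import all_boot all_order all_algebra.
From mathcomp Require Import all_classical all_reals all_analysis.
From mathcomp Require Import ring.
Set Implicit Arguments.
Unset Strict Implicit.
Unset Printing Implicit Defensive.
Import Order.TTheory GRing.Theory Num.Theory.
Import numFieldNormedType.Exports.
Local Open Scope ring_scope.

(* The exterior product of double forms is associative, and it is commutative *)
(* on sums of (p,p) double forms, so d/dt R^k = k R' R^(k-1) by the product    *)
(* rule, and the derivative of h_2k is k/(n-2k)! * (R' (g^(n-2k) R^(k-1))).    *)
(* Expanding this (n,n) double form on (E, E), E = e_1 /\ ... /\ e_n, over     *)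
(* complementary pairs of masks gives the inner product of R' with the Hodge   *)
(* star, because the volume of e_A /\ e_(~A) is the sign of the shuffle A.     *)

(** Differentiation produces [R'] paired with the dual of what multiplies it. Commutativity
    ([df_mulC]) holds because the two tensor factors contribute equal signs, which cancel; with
    [df_mulA] it lets [is_derive_df_pow] collect all [k] terms of the product rule. No sign is left
    in the pairing either: the shuffle signs in the expansion [df_mul_tuple] of a product on the
    full basis are exactly those in [df_star_mask], which rests on the permutation determinants of
    [det_masks_indicator]. *)

Lemma big_tuple_bool0 (K : nmodType) (F : bitseq -> K) :
  \sum_(m : 0.-tuple bool) F m = F [::].
Proof.
rewrite (bigD1 [tuple]) //= big1 ?addr0 // => m.
by case/negP; apply/eqP; exact: tuple0.
Qed.

Lemma big_tuple_boolS (K : nmodType) (n : nat) (F : bitseq -> K) :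
  \sum_(m : n.+1.-tuple bool) F m
  = \sum_(m : n.-tuple bool) F (true :: m) + \sum_(m : n.-tuple bool) F (false :: m).
Proof.
rewrite (reindex (fun p : bool * n.-tuple bool => [tuple of p.1 :: p.2])) /=.
  by rewrite -(pair_bigA _ (fun (b : bool) (m : n.-tuple bool) => F (b :: m))) /= big_bool.
exists (fun m => (thead m, [tuple of behead m])) => [[b m] _ | m _] /=.
  by congr (_, _); exact/val_inj.
by rewrite -tuple_eta.
Qed.

Lemma big_tuple_bool_compl (K : nmodType) (n : nat) (F : bitseq -> K) :
  \sum_(m : n.-tuple bool) F m = \sum_(m : n.-tuple bool) F (map negb m).
Proof.
pose c (m : n.-tuple bool) := [tuple of map negb m].
have cK : involutive c.
  by move=> m; apply: val_inj; rewrite /= -map_comp map_id_in // => b _ /=; rewrite negbK.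
by rewrite (reindex_inj (inv_inj cK)).
Qed.

Lemma shuffle_sign_nil (K : realType) : shuffle_sign K [::] = 1.
Proof. by rewrite /shuffle_sign big_ord0. Qed.

Lemma shuffle_sign_true (K : realType) (m : bitseq) :
  shuffle_sign K (true :: m) = shuffle_sign K m.
Proof.
rewrite /shuffle_sign; congr (_ ^+ _).
rewrite /= big_ord_recl /= big1 // add0n; apply: eq_bigr => i _.
by rewrite big_mkcond big_ord_recl /= add0n -big_mkcond.
Qed.

(** An unselected position placed in front forms an inversion with every selected position of
    [m]. *)
Lemma shuffle_sign_false (K : realType) (m : bitseq) :
  shuffle_sign K (false :: m) = (-1) ^+ count id m * shuffle_sign K m.
Proof.
rewrite /shuffle_sign -exprD; congr (_ ^+ _).
rewrite /= big_ord_recl /=; congr (_ + _)%N.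
  rewrite big_mkcond big_ord_recl /= add0n -sum1_count [RHS]big_mkcond [RHS](big_nth false) big_mkord.
  by apply: eq_bigr => i _ /=; case: (nth _ _ _).
by apply: eq_bigr => i _; rewrite big_mkcond big_ord_recl /= add0n -big_mkcond.
Qed.

(** Each pair of one selected and one unselected position is an inversion for exactly one of [m] and
    its complement. *)
Lemma shuffle_sign_compl (K : realType) (m : bitseq) :
  shuffle_sign K (map negb m)
  = (-1) ^+ (count id m * count negb m) * shuffle_sign K m.
Proof.
elim: m => [|[] m IH] /=; first by rewrite shuffle_sign_nil mulr1.
  rewrite shuffle_sign_false shuffle_sign_true IH add0n mulnDl mul1n exprD mulrA.
  by rewrite count_map.
by rewrite shuffle_sign_true shuffle_sign_false IH add0n mulnDr muln1 exprD mulrACA -expr2 sqrr_sign mul1r.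
Qed.

(** * Commutativity and associativity of the exterior product *)

(** Complementing both masks exchanges the factors and costs the sign $(-1)^{pq}$ once for [x] and
    once for [y]; the vanishing hypotheses make the two degrees [p], [q] the same in both
    arguments. *)
Lemma df_mulC (K : realType) (V : vectType K) (om mu : seq V -> seq V -> K) :
  (forall x y, size x != size y -> om x y = 0) ->
  (forall x y, size x != size y -> mu x y = 0) ->
  df_mul om mu = df_mul mu om.
Proof.
move=> om0 mu0; apply/funext => x; apply/funext => y; rewrite /df_mul.
rewrite [LHS](big_tuple_bool_compl _ (fun m => \sum_(m' : (size y).-tuple bool)
     shuffle_sign K m * shuffle_sign K m'
     * om (mask m x) (mask m' y)
     * mu (mask (map negb m) x) (mask (map negb m') y))).
apply: eq_bigr => m _.
rewrite (big_tuple_bool_compl _ (fun m' => _ * shuffle_sign K m'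
     * om _ (mask m' y) * mu _ (mask (map negb m') y))).
apply: eq_bigr => m' _; rewrite -!map_comp !(@eq_map _ _ (negb \o negb) id) ?map_id;
  try exact: negbK.
have [/eqP s1|/om0 ->] := boolP (size (mask (map negb m) x) == size (mask (map negb m') y));
  last by rewrite !mulr0 mul0r.
have [/eqP s2|/mu0 ->] := boolP (size (mask m x) == size (mask m' y));
  last by rewrite !mulr0 mul0r.
move: s1 s2; rewrite !size_mask ?size_map ?size_tuple // !count_map.
rewrite !(@eq_count _ (preim negb id) negb) // !shuffle_sign_compl => -> ->.
set c := (-1) ^+ _; have cc : c * c = 1 by rewrite -expr2 sqrr_sign.
rewrite -[RHS]mul1r -cc; ring.
Qed.

(* Contraction in the first vector and the parity sign satisfy the graded      *)
(* Leibniz rule df_contract1M; associativity follows from it by induction.     *)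
Definition df_contract1 (K : realType) (V : vectType K) (a : V)
  (om : seq V -> seq V -> K) : seq V -> seq V -> K := fun x y => om (a :: x) y.

Definition df_contract2 (K : realType) (V : vectType K) (b : V)
  (om : seq V -> seq V -> K) : seq V -> seq V -> K := fun x y => om x (b :: y).

Definition df_parity1 (K : realType) (V : vectType K)
  (om : seq V -> seq V -> K) : seq V -> seq V -> K := fun x y => (-1) ^+ size x * om x y.

Definition df_parity2 (K : realType) (V : vectType K)
  (om : seq V -> seq V -> K) : seq V -> seq V -> K := fun x y => (-1) ^+ size y * om x y.

(** The vector [a] goes either to [om] or to [mu]; in the second case it passes all the vectors
    given to [om], whence the parity twist. *)
Lemma df_mul_cons1 (K : realType) (V : vectType K) (om mu : seq V -> seq V -> K) a x y :
  df_mul om mu (a :: x) y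
  = df_mul (df_contract1 a om) mu x y + df_mul (df_parity1 om) (df_contract1 a mu) x y.
Proof.
rewrite /df_mul (big_tuple_boolS _ (fun m => \sum_(m' : (size y).-tuple bool)
     shuffle_sign K m * shuffle_sign K m'
     * om (mask m (a :: x)) (mask m' y)
     * mu (mask (map negb m) (a :: x)) (mask (map negb m') y))) /=.
congr (_ + _); apply: eq_bigr => m _; apply: eq_bigr => m' _.
  by rewrite shuffle_sign_true.
by rewrite shuffle_sign_false /df_parity1 size_mask ?size_tuple // /df_contract1; ring.
Qed.

Lemma df_mul_cons2 (K : realType) (V : vectType K) (om mu : seq V -> seq V -> K) b x y :
  df_mul om mu x (b :: y)
  = df_mul (df_contract2 b om) mu x y + df_mul (df_parity2 om) (df_contract2 b mu) x y.
Proof.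
rewrite /df_mul -big_split; apply: eq_bigr => m _ /=.
rewrite (big_tuple_boolS _ (fun m' => shuffle_sign K m * shuffle_sign K m'
     * om (mask m x) (mask m' (b :: y))
     * mu (mask (map negb m) x) (mask (map negb m') (b :: y)))) /=.
congr (_ + _); apply: eq_bigr => m' _.
  by rewrite shuffle_sign_true.
by rewrite shuffle_sign_false /df_parity2 size_mask ?size_tuple // /df_contract2; ring.
Qed.

Lemma df_mul_nil (K : realType) (V : vectType K) (om mu : seq V -> seq V -> K) :
  df_mul om mu [::] [::] = om [::] [::] * mu [::] [::].
Proof.
rewrite /df_mul.
rewrite (big_tuple_bool0 (fun m => \sum_(m' : 0.-tuple bool)
     shuffle_sign K m * shuffle_sign K m'
     * om (mask m [::]) (mask m' [::])
     * mu (mask (map negb m) [::]) (mask (map negb m') [::]))) /=.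
rewrite (big_tuple_bool0 (fun m' => shuffle_sign K [::] * shuffle_sign K m'
     * om [::] (mask m' [::]) * mu [::] (mask (map negb m') [::]))) /=.
by rewrite shuffle_sign_nil !mul1r.
Qed.

Lemma df_mulDl (K : realType) (V : vectType K) (om1 om2 mu : seq V -> seq V -> K) :
  df_mul (om1 + om2) mu = df_mul om1 mu + df_mul om2 mu.
Proof.
apply/funext => x; apply/funext => y; rewrite /df_mul !fctE -big_split.
apply: eq_bigr => m _; rewrite /= -big_split; apply: eq_bigr => m' _ /=.
by rewrite mulrDr mulrDl.
Qed.

Lemma df_mulDr (K : realType) (V : vectType K) (om mu1 mu2 : seq V -> seq V -> K) :
  df_mul om (mu1 + mu2) = df_mul om mu1 + df_mul om mu2.
Proof.
apply/funext => x; apply/funext => y; rewrite /df_mul !fctE -big_split.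
apply: eq_bigr => m _; rewrite /= -big_split; apply: eq_bigr => m' _ /=.
by rewrite mulrDr.
Qed.

Lemma df_mulZr (K : realType) (V : vectType K) (c : K) (om mu : seq V -> seq V -> K) :
  df_mul om (df_scale c mu) = df_scale c (df_mul om mu).
Proof.
apply/funext => x; apply/funext => y; rewrite /df_mul /df_scale mulr_sumr.
apply: eq_bigr => m _; rewrite mulr_sumr; apply: eq_bigr => m' _.
by rewrite mulrCA.
Qed.

Lemma size_mask_compl (T : Type) (m : bitseq) (x : seq T) : size m = size x ->
  (size (mask m x) + size (mask (map negb m) x))%N = size x.
Proof.
move=> mx; rewrite !size_mask ?size_map // count_map -mx.
by rewrite (@eq_count _ (preim negb id) (predC id)) // count_predC.
Qed.

Lemma df_parity1M (K : realType) (V : vectType K) (om mu : seq V -> seq V -> K) :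
  df_parity1 (df_mul om mu) = df_mul (df_parity1 om) (df_parity1 mu).
Proof.
apply/funext => x; apply/funext => y; rewrite /df_parity1 /df_mul mulr_sumr.
apply: eq_bigr => m _; rewrite mulr_sumr; apply: eq_bigr => m' _.
by rewrite -{1}(@size_mask_compl _ m x) ?size_tuple // exprD; ring.
Qed.

Lemma df_parity2M (K : realType) (V : vectType K) (om mu : seq V -> seq V -> K) :
  df_parity2 (df_mul om mu) = df_mul (df_parity2 om) (df_parity2 mu).
Proof.
apply/funext => x; apply/funext => y; rewrite /df_parity2 /df_mul mulr_sumr.
apply: eq_bigr => m _; rewrite mulr_sumr; apply: eq_bigr => m' _.
by rewrite -{1}(@size_mask_compl _ m' y) ?size_tuple // exprD; ring.
Qed.

Lemma df_contract1M (K : realType) (V : vectType K) (a : V) (om mu : seq V -> seq V -> K) :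
  df_contract1 a (df_mul om mu)
  = df_mul (df_contract1 a om) mu + df_mul (df_parity1 om) (df_contract1 a mu).
Proof. by apply/funext => x; apply/funext => y; exact: df_mul_cons1. Qed.

Lemma df_contract2M (K : realType) (V : vectType K) (b : V) (om mu : seq V -> seq V -> K) :
  df_contract2 b (df_mul om mu)
  = df_mul (df_contract2 b om) mu + df_mul (df_parity2 om) (df_contract2 b mu).
Proof. by apply/funext => x; apply/funext => y; exact: df_mul_cons2. Qed.

Lemma df_mulA (K : realType) (V : vectType K) (om mu nu : seq V -> seq V -> K) :
  df_mul om (df_mul mu nu) = df_mul (df_mul om mu) nu.
Proof.
(* The forms are generalized because the induction hypothesis is applied to their contractions and
   parity twists. *)
apply/funext => x; apply/funext => y; elim: x => [|a x IH] in om mu nu *.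
  elim: y => [|b y IH] in om mu nu *; first by rewrite !df_mul_nil mulrA.
  rewrite !df_mul_cons2 !df_contract2M df_parity2M df_mulDl df_mulDr !fctE.
  by rewrite !IH addrA.
rewrite !df_mul_cons1 !df_contract1M df_parity1M df_mulDl df_mulDr !fctE.
by rewrite !IH addrA.
Qed.

Lemma df_mulCA (K : realType) (V : vectType K) (om mu nu : seq V -> seq V -> K) :
  (forall x y, size x != size y -> om x y = 0) ->
  (forall x y, size x != size y -> mu x y = 0) ->
  df_mul om (df_mul mu nu) = df_mul mu (df_mul om nu).
Proof. by move=> om0 mu0; rewrite !df_mulA (df_mulC om0 mu0). Qed.

(** * Determinants of index masks *)

(* Expansion along the first row, whose only nonzero entry is in column        *)
(* size s1.                                                                     *)
Lemma det_shifted_indicator (K : comNzRingType) (s1 s2 : seq nat) (n : nat) :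
  (size s1 + size s2 = n)%N ->
  \det (\matrix_(i < n.+1, j < n.+1)
     ((i : nat) == nth 0 (map S s1 ++ 0 :: map S s2) j)%:R : 'M[K]_n.+1)
  = (-1) ^+ size s1 * \det (\matrix_(i < n, j < n) ((i : nat) == nth 0 (s1 ++ s2) j)%:R).
Proof.
move=> sz; have ltp : (size s1 < n.+1)%N by rewrite ltnS -sz leq_addr.
rewrite (expand_det_row _ ord0) (bigD1 (Ordinal ltp)) //= big1 ?addr0.
  rewrite mxE /= nth_cat size_map ltnn subnn eqxx mul1r /cofactor add0n /=.
  congr (_ * \det _); apply/matrixP => i j; rewrite !mxE /= !nth_cat size_map /bump.
  rewrite leq0n add1n; have [jp|pj] := ltnP j (size s1).
    by rewrite add0n jp (nth_map 0).
  rewrite add1n ltnNge leqW //= subSn //= (nth_map 0) //.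
  by rewrite ltn_subLR // sz.
move=> j jp; rewrite mxE nth_cat size_map.
have {}jp : (j : nat) != size s1 by [].
case: ltngtP jp => // [jp|pj] _; first by rewrite (nth_map 0) // mul0r.
have -> : (j - size s1 = (j - (size s1).+1).+1)%N.
  by rewrite subnS prednK // subn_gt0.
by rewrite /= (nth_map 0) ?mul0r // ltn_subLR // addSn sz.
Qed.

(** Induction on the first index, which must be selected by exactly one of [A] and [I]; if [I]
    selects it, its column stands after those of [A], and the cofactor sign is the one of
    [shuffle_sign_false]. *)
Lemma det_masks_indicator (K : realType) (n : nat) (A I : bitseq) :
  size A = n -> size I = n ->
  size (mask A (iota 0 n) ++ mask I (iota 0 n)) = n ->
  \det (\matrix_(i < n, j < n)
     ((i : nat) == nth 0 (mask A (iota 0 n) ++ mask I (iota 0 n)) j)%:R)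
  = (I == map negb A)%:R * shuffle_sign K A.
Proof.
elim: n A I => [|n IH] [|a A] [|b I] //; first by rewrite det_mx00 shuffle_sign_nil mulr1.
move=> [sA] [sI]; rewrite /= -add1n iotaDl (eq_map add1n) -!map_mask.
move: IH => /(_ A I sA sI).
rewrite !size_cat /= !size_mask ?size_map ?size_iota // => IH.
case: a b => [] [] /=; rewrite ?size_map ?size_mask ?size_iota // ?addnS ?addSn => -[] sz.
(* Both masks select index 0, so columns 0 and [(count id A).+1] coincide. *)
- rewrite mul0r -det_tr.
  have ltp : (count id A < n)%N by rewrite -[X in (_ < X)%N]sz ltnS leq_addr.
  apply: (@determinant_alternate _ _ _ ord0 (Ordinal (ltp : ((count id A).+1 < n.+1)%N))) => //.
  move=> j; rewrite !mxE /= nth_cat size_map size_mask ?size_iota //.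
  by rewrite ltnn subnn.
- rewrite -map_cat (@det_shifted_indicator _ [::] (mask A (iota 0 n) ++ mask I (iota 0 n))).
    by rewrite expr0 mul1r IH // shuffle_sign_true eqseq_cons.
  by rewrite size_cat !size_mask ?size_iota.
- rewrite det_shifted_indicator ?size_mask ?size_iota // IH //.
  by rewrite shuffle_sign_false eqseq_cons mulrCA.
(* Neither mask selects index 0, so the first row vanishes. *)
- rewrite mul0r (expand_det_row _ ord0) big1 // => j _.
  rewrite mxE -map_cat (nth_map 0) ?mul0r //.
  by rewrite size_cat !size_mask ?size_iota // sz.
Qed.

(** * Differentiation of products and powers *)

Lemma is_derive_big_sum (K : realType) (I : Type) (r : seq I) (F : I -> K -> K)
    (dF : I -> K) (t : K) :
  (forall i, is_derive t 1 (F i) (dF i)) ->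
  is_derive t 1 (fun s => \sum_(i <- r) F i s) (\sum_(i <- r) dF i).
Proof.
move=> dFt; rewrite -fct_sumE.
by elim/big_ind2 : _ => // [|*]; [exact: is_derive_cst|exact: is_deriveD].
Qed.

Lemma is_derive_df_mul (K : realType) (V : vectType K)
    (A B : K -> seq V -> seq V -> K) (A' B' : seq V -> seq V -> K) (t : K) :
  (forall x y, is_derive t 1 (fun s => A s x y) (A' x y)) ->
  (forall x y, is_derive t 1 (fun s => B s x y) (B' x y)) ->
  forall x y, is_derive t 1 (fun s => df_mul (A s) (B s) x y)
    (df_mul A' (B t) x y + df_mul (A t) B' x y).
Proof.
move=> dA dB x y; rewrite /df_mul -big_split; apply: is_derive_big_sum => m /=.
rewrite -big_split; apply: is_derive_big_sum => m' /=.
set c := shuffle_sign K m * _.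
have -> : (fun s => c * A s (mask m x) (mask m' y)
    * B s (mask (map negb m) x) (mask (map negb m') y))
  = (c \*: (fun s => A s (mask m x) (mask m' y)))
    * (fun s => B s (mask (map negb m) x) (mask (map negb m') y)) by [].
apply: is_derive_eq.
rewrite /= /GRing.scale /=; ring.
Qed.

Lemma df_mul_balanced (K : realType) (V : vectType K) (om mu : seq V -> seq V -> K) :
  (forall x y, size x != size y -> om x y = 0) ->
  (forall x y, size x != size y -> mu x y = 0) ->
  forall x y, size x != size y -> df_mul om mu x y = 0.
Proof.
move=> om0 mu0 x y xy; apply: big1 => m _; apply: big1 => m' _.
have [/eqP s1|/om0 ->] := boolP (size (mask m x) == size (mask m' y));
  last by rewrite mulr0 mul0r.
have [/eqP s2|/mu0 ->] := boolP (size (mask (map negb m) x) == size (mask (map negb m') y));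
  last by rewrite mulr0.
case/negP: xy; rewrite -(@size_mask_compl _ m x) ?size_tuple //.
by rewrite -(@size_mask_compl _ m' y) ?size_tuple // s1 s2.
Qed.

Lemma df_pow_balanced (K : realType) (V : vectType K) (om : seq V -> seq V -> K) (k : nat) :
  (forall x y, size x != size y -> om x y = 0) ->
  forall x y, size x != size y -> df_pow om k x y = 0.
Proof.
move=> om0; elim: k => [|k IH]; last exact: df_mul_balanced.
by move=> [|a x] [|b y].
Qed.

(** Each term of the product rule has [R'] in a different place; [df_mulCA] brings it to the
    front. *)
Lemma is_derive_df_pow (K : realType) (V : vectType K)
    (R : K -> seq V -> seq V -> K) (R' : seq V -> seq V -> K) (t : K) (k : nat) :
  (forall x y, size x != size y -> R t x y = 0) ->
  (forall x y, size x != size y -> R' x y = 0) ->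
  (forall x y, is_derive t 1 (fun s => R s x y) (R' x y)) ->
  forall x y, is_derive t 1 (fun s => df_pow (R s) k x y)
    (df_scale k%:R (df_mul R' (df_pow (R t) k.-1)) x y).
Proof.
move=> R0 R'0 dR; elim: k => [|k IH] x y.
  by rewrite /df_scale mul0r; exact: is_derive_cst.
apply: is_derive_eq; first exact: (is_derive_df_mul dR IH).
rewrite df_mulZr /df_scale df_mulCA //= mulrS mulrDl mul1r; congr (_ + _).
(* For exponent 0 the predecessor is truncated, but the coefficient is 0 there. *)
by case: k {IH} => [|k]; rewrite ?mul0r.
Qed.

(** * The Hodge star in an orthonormal basis *)

Lemma orthonormal_nth (K : realType) (V : vectType K) (g : {dot V for idfun})
    (s : seq V) (i j : nat) :
  orthonormal g s -> (i < size s)%N -> (j < size s)%N ->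
  g (nth 0 s i) (nth 0 s j) = (i == j)%:R.
Proof.
have gC u v : g u v = g v u by rewrite hermC mul1r.
elim: s i j => [//|a s IH] i j /andP[/= /andP[/eqP aa s1] /andP[]].
rewrite andbT => /allP as0 so.
case: i j => [|i] [|j] //=; rewrite ?ltnS => si sj.
- by rewrite (eqP (as0 _ (mem_nth 0 sj))).
- by rewrite gC (eqP (as0 _ (mem_nth 0 si))).
- by rewrite IH // /orthonormal s1.
Qed.

(** Orthonormality turns the matrix of scalar products into the indicator matrix of the masked
    indices. When the total length is not [n], the masks cannot be complementary and both sides
    vanish. *)
Lemma volume_form_masks (K : realType) (V : vectType K) (g : {dot V for idfun})
    (n : nat) (e : n.-tuple V) (A I : n.-tuple bool) :
  orthonormal g e ->
  volume_form g e (mask A e ++ mask I e)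
  = (I == [tuple of map negb A])%:R * shuffle_sign K A.
Proof.
move=> oe; rewrite /volume_form -[I == _]/(tval I == map negb A).
have eE m : mask m e = map (nth 0 e) (mask m (iota 0 n)).
  by rewrite map_mask -[n in iota 0 n](size_tuple e) -/(mkseq _ _) mkseq_nth.
case: ifPn => [/eqP|] sz.
  rewrite -(@det_masks_indicator K n) ?size_tuple //; last first.
    by move: sz; rewrite !eE -map_cat size_map.
  congr (\det _); apply/matrixP => i j; rewrite !mxE !eE -map_cat (nth_map 0); last first.
    by move: sz; rewrite !eE -map_cat size_map => ->.
  rewrite (tnth_nth 0) orthonormal_nth ?size_tuple //.
  have : nth 0 (mask A (iota 0 n) ++ mask I (iota 0 n)) j \in mask A (iota 0 n) ++ mask I (iota 0 n).
    by apply: mem_nth; move: sz; rewrite !eE -map_cat size_map => ->.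
  by rewrite mem_cat => /orP[] /mem_mask; rewrite mem_iota.
case: eqP => [IA|_]; last by rewrite mul0r.
by move: sz; rewrite size_cat IA size_mask_compl ?size_tuple ?eqxx.
Qed.

Lemma df_star_mask (K : realType) (V : vectType K) (g : {dot V for idfun})
    (n : nat) (e : n.-tuple V) (om : seq V -> seq V -> K) (A B : n.-tuple bool) :
  orthonormal g e ->
  df_star g e om (mask A e) (mask B e)
  = shuffle_sign K A * shuffle_sign K B * om (mask (map negb A) e) (mask (map negb B) e).
Proof.
move=> oe; rewrite /df_star (bigD1 [tuple of map negb A]) //= [X in _ + X]big1 ?addr0.
  rewrite (bigD1 [tuple of map negb B]) //= [X in _ + X]big1 ?addr0.
    by rewrite !volume_form_masks // !eqxx !mul1r.
  move=> J /negbTE JB; rewrite [volume_form g e (mask B e ++ _)]volume_form_masks //.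
  by rewrite JB mul0r mulr0 mul0r.
by move=> I /negbTE IA; apply: big1 => J _; rewrite volume_form_masks // IA !mul0r.
Qed.

Lemma df_scalar_star (K : realType) (V : vectType K) (g : {dot V for idfun})
    (n : nat) (e : n.-tuple V) (om : seq V -> seq V -> K) :
  orthonormal g e -> df_scalar (df_star g e om) = om e e.
Proof.
(* The all-false mask presents [[::]] as a mask of [e]; its complement selects all of [e]. *)
move=> oe; pose A := nseq_tuple n false.
have -> : df_scalar (df_star g e om) = df_star g e om (mask A e) (mask A e).
  by rewrite mask_false.
have sA : shuffle_sign K A * shuffle_sign K A = 1.
  by rewrite /shuffle_sign -expr2 sqrr_sign.
by rewrite df_star_mask // sA mul1r map_nseq mask_true // size_tuple.
Qed.

(** [df_mul] sums over masks of length [size e], which equals [n] only propositionally; substituting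
    for [n] aligns the index types. *)
Lemma df_mul_tuple (K : realType) (V : vectType K) (n : nat) (e : n.-tuple V)
    (om mu : seq V -> seq V -> K) :
  df_mul om mu e e = \sum_(A : n.-tuple bool) \sum_(B : n.-tuple bool)
     shuffle_sign K A * shuffle_sign K B * om (mask A e) (mask B e)
     * mu (mask (map negb A) e) (mask (map negb B) e).
Proof. by case: e => s /= se; case: _ / (eqP se). Qed.

Theorem proposition3p9 (K : realType) (V : vectType K) (g : {dot V for idfun})
    (n : nat) (dimV : \dim {:V} = n)
    (e : n.-tuple V) (orthonormal_e : orthonormal g e)
    (R : K -> seq V -> seq V -> K)
    (R_df : forall t, is_double_form 2 2 (R t))
    (R_sym : forall t, symmetric_df (R t))
    (R_bianchi : forall t, first_bianchi (R t))
    (t : K) (R_diff : forall x y, derivable (fun s => R s x y) t 1)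
    (k : nat) (hk : (4 <= 2 * k <= n)%N) :
  is_derive t 1 (fun s => h_2k g e k (R s))
    (df_inner e (df_scale k%:R (N_2k2 g e k (R t))) (df_ddt R t)).
Proof.
have R0 s x y : size x != size y -> R s x y = 0.
  case: (R_df s) => [/(_ y)[R1 _ _] /(_ x)[R2 _ _]].
  by have [->|/R1] := eqVneq (size x) 2; first by rewrite eq_sym => /R2.
have R'0 x y : size x != size y -> df_ddt R t x y = 0.
  move=> xy; rewrite /df_ddt (_ : (fun s => _) = cst 0) ?derive1_cst //.
  by apply/funext => s; exact: R0.
have dR x y : is_derive t 1 (fun s => R s x y) (df_ddt R t x y).
  by rewrite /df_ddt derive1E; exact/derivableP.
set G := df_pow (metric_df g) (n - 2 * k).
have G0 x y : size x != size y -> G x y = 0.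
  by apply: df_pow_balanced => -[|a [|b u]] [|c [|d v]].
set c := ((n - 2 * k)`!%:R)^-1 : K.
have -> : (fun s => h_2k g e k (R s))
    = c \*: (fun s => df_mul G (df_pow (R s) k) e e).
  by apply/funext => s; rewrite /h_2k df_scalar_star.
(* The power of the metric enters the product rule as a constant family. *)
have dG x y : is_derive t 1 (fun=> G x y) ((fun _ _ => 0) x y).
  exact: is_derive_cst.
apply: is_derive_eq.
  apply: is_deriveZ; apply: (@is_derive_df_mul _ _ (fun=> G) _ _ _ _ dG).
  exact: (is_derive_df_pow _ (R0 t) R'0 dR).
rewrite [X in c *: (X + _)]big1 ?add0r; last first.
  by move=> m _; apply: big1 => m' _; rewrite mulr0 mul0r.
(* With [R'] moved in front of [G], the product on [(e, e)] expands over masks [A], [B] into values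
   of [R'] at [A], [B] times signed values of [G R^(k-1)] at the complements, which [df_star_mask]
   identifies with the Hodge star. *)
rewrite df_mulZr df_mulCA // /df_scale df_mul_tuple /df_inner /GRing.scale /=.
rewrite !mulr_sumr; apply: eq_bigr => A _; rewrite !mulr_sumr; apply: eq_bigr => B _.
rewrite /N_2k2 df_star_mask // -/G -/c /df_scale. ring.
Qed.
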